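(* Let $f$ be an analytic function from $\mathbb{D}$ into $\overline{\mathbb{D}}$ with $f(z) = \sum_{n=0}^{\infty} a_nz^n$ for $z\in\mathbb{D}$. Then, for each $n\ge 1$, $$1 - |a_0|^2 - |a_n| \ge \frac{\left|a_{2n}(1-|a_0^2|)+a_n^2\overline{a_0}\right|}{2(1-|a_0|^2)}.$$
   Context: $\mathbb{D}$ is the open unit disk in $\mathbb{C}$ and $\overline{\mathbb{D}}$ is the closed unit disk. *)

(* Defs.v *)
From Stdlib Require Import Reals.
From Coquelicot Require Import Coquelicot.
Open Scope R_scope.

Definition unit_disk (z : C) : Prop := Cmod z < 1.

Definition closed_unit_disk (z : C) : Prop := Cmod z <= 1.

(* [U] is meant to be open.  Fixing the scalar field to [C_AbsRing] makes
   [ex_derive] complex (not real) differentiability; being local, it does not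
   depend on the values of the total function [f] outside [U]. *)
Definition analytic_on (U : C -> Prop) (f : C -> C) : Prop :=
  forall z : C, U z -> @ex_derive C_AbsRing C_NormedModule f z.

(* Main.v *)
Require Import Defs.
From Stdlib Require Import Reals Lra Lia.
From Coquelicot Require Import Coquelicot.
Open Scope R_scope.

(** Write [a], [b], [c] for the coefficients of index [0], [n], [2n] of [f], and
    put [A = 1 - |a|^2].

    Multiplication by [f] does not increase the mean square over a circle,
    because [|f| <= 1].  Comparing the coefficients of [p] and [f p] for
    [p = p0 + p1 z^n + p2 z^(2n)] therefore shows that the lower triangular
    Toeplitz matrix [T] with first column [(a, b, c)] is a contraction of
    [C^3] ([schur_toeplitz_contraction]).  All means are finite ones: on a
    circle of radius [r < 1] the function is replaced by a partial sum of its
    series, bounded there by [1 + e] ([partial_sums_nearly_schur]), and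
    Parseval's identity is used for a polynomial sampled at the roots of unity
    of an order exceeding its degree ([parseval]).  Then [e -> 0] and
    [r -> 1].

    The estimate itself is linear algebra
    ([toeplitz_contraction_coefficients]).  The Schur transform
    [(T - a) (1 - a^* T)^(-1)] is again a contraction, with first column
    [(0, g0, g1)], where [g0 = b / A] and [g1 = (c A + b^2 a^* ) / A^2].
    Applying it to [(1, u, 0)], with [|u| = 1] chosen so that [g1] and [g0 u]
    have the same argument, gives
      [|g0|^2 + (|g1| + |g0|)^2 <= 2].
    The line [|g1| = 2 (1 - |g0|)] is tangent to the boundary of this convex
    region at [(|g0|, |g1|) = (1, 0)], so [|g1| <= 2 (1 - |g0|)]; multiplied by
    [A / 2] this is the claim.  If [A = 0], the first column of [T] has norm
    at most [1 = |a|], so [b = c = 0] and both sides vanish. *)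

(** * Finite sums of complex numbers *)

(** Equalities produced by lemmas on [sum_n] live in a structure carrier that
    is convertible, but not syntactically equal, to [C]; [ring] needs the
    latter. *)
Ltac cring := match goal with |- ?x = ?y => change (@eq C x y); ring end.

Lemma csum_S (u : nat -> C) (n : nat) :
  sum_n u (S n) = (sum_n u n + u (S n))%C.
Proof. exact (sum_Sn u n). Qed.

Lemma csum_mult_l (x : C) (u : nat -> C) (n : nat) :
  sum_n (fun k => (x * u k)%C) n = (x * sum_n u n)%C.
Proof. exact (sum_n_mult_l (K := C_Ring) x u n). Qed.

Lemma csum_mult_r (x : C) (u : nat -> C) (n : nat) :
  sum_n (fun k => (u k * x)%C) n = (sum_n u n * x)%C.
Proof. exact (sum_n_mult_r (K := C_Ring) x u n). Qed.

Lemma csum_conj (u : nat -> C) (n : nat) :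
  Cconj (sum_n u n) = sum_n (fun k => Cconj (u k)) n.
Proof.
  induction n as [|n IH].
  - now rewrite !sum_O.
  - now rewrite !csum_S, Cplus_conj, IH.
Qed.

Lemma csum_RtoC (u : nat -> R) (n : nat) :
  RtoC (sum_n u n) = sum_n (fun k => RtoC (u k)) n.
Proof.
  induction n as [|n IH].
  - now rewrite !sum_O.
  - rewrite csum_S, sum_Sn, <- IH. apply RtoC_plus.
Qed.

Lemma sum_zero_above {G : AbelianMonoid} (u : nat -> G) (m n : nat) :
  (m <= n)%nat -> (forall k, (m < k)%nat -> u k = zero) ->
  sum_n u n = sum_n u m.
Proof.
  intros Hmn Hu.
  induction Hmn as [|n Hmn IH]; [easy|].
  rewrite sum_Sn, IH, Hu by lia. apply plus_zero_r.
Qed.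

Lemma sum_zero {G : AbelianMonoid} (u : nat -> G) (n : nat) :
  (forall k, (k <= n)%nat -> u k = zero) -> sum_n u n = zero.
Proof.
  intros Hu. induction n as [|n IH].
  - rewrite sum_O. now apply Hu.
  - rewrite sum_Sn, IH, Hu by (intros; try apply Hu; lia). apply plus_zero_r.
Qed.

Lemma sum_single {G : AbelianMonoid} (u : nat -> G) (j n : nat) :
  (j <= n)%nat -> (forall k, k <> j -> u k = zero) -> sum_n u n = u j.
Proof.
  intros Hj Hu.
  rewrite (sum_zero_above u j n Hj) by (intros; apply Hu; lia).
  destruct j as [|j]; [apply sum_O|].
  rewrite sum_Sn, sum_zero by (intros; apply Hu; lia). apply plus_zero_l.
Qed.

(** * Roots of unity and Parseval's identity *)

Definition cis (t : R) : C := (cos t, sin t).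

Lemma cis_plus (s t : R) : cis (s + t) = (cis s * cis t)%C.
Proof.
  unfold cis, Cmult; simpl.
  rewrite cos_plus, sin_plus. f_equal; ring.
Qed.

Lemma cis_conj (t : R) : Cconj (cis t) = cis (- t).
Proof. unfold cis, Cconj; simpl. now rewrite cos_neg, sin_neg. Qed.

Lemma cis_pow (t : R) (n : nat) : (cis t ^ n)%C = cis (INR n * t).
Proof.
  induction n as [|n IH].
  - simpl. rewrite Rmult_0_l. unfold cis. now rewrite cos_0, sin_0.
  - rewrite S_INR, Cpow_S, IH, <- cis_plus. f_equal. ring.
Qed.

Lemma Cmod_cis (t : R) : Cmod (cis t) = 1.
Proof.
  unfold Cmod, cis; simpl.
  replace (_ + _) with 1; [apply sqrt_1|].
  generalize (sin2_cos2 t); unfold Rsqr; lra.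
Qed.

(** By the half-angle formula, [cos t = 1] forces [sin (t / 2) = 0]. *)
Lemma cis_neq_1 (t : R) : t <> 0 -> - (2 * PI) < t < 2 * PI -> cis t <> 1.
Proof.
  intros Ht0 Ht Heq.
  assert (Hcos : cos t = 1) by (injection Heq; auto).
  replace t with (2 * (t / 2)) in Hcos by field.
  rewrite cos_2a_sin in Hcos.
  assert (Hsin : sin (t / 2) <> 0).
  { destruct (Rdichotomy _ _ Ht0) as [Hn|Hp].
    - apply Rlt_not_eq, sin_lt_0_var; lra.
    - apply Rgt_not_eq, sin_gt_0; lra. }
  apply Hsin, Rsqr_0_uniq. unfold Rsqr. lra.
Qed.

Lemma geometric_sum (z : C) (n : nat) :
  ((z - 1) * sum_n (fun k => z ^ k) n = z ^ S n - 1)%C.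
Proof.
  induction n as [|n IH].
  - rewrite sum_O. simpl. ring.
  - rewrite csum_S, Cmult_plus_distr_l, IH, !Cpow_S. ring.
Qed.

Definition unity_root (N : nat) : C := cis (2 * PI / INR N).

(** The [k]-th summand is the [k]-th power of [w = cis t], where [t] is [l - m]
    times the basic angle, so the sum is geometric; [w] is a root of unity of
    order dividing [S M], and it differs from [1] since [0 < |l - m| < S M]. *)
Lemma unity_root_orthogonality (M l m : nat) :
  (l <= M)%nat -> (m <= M)%nat ->
  sum_n (fun k => ((unity_root (S M) ^ k) ^ l
                   * Cconj ((unity_root (S M) ^ k) ^ m))%C) M
  = if Nat.eqb l m then RtoC (INR (S M)) else RtoC 0.
Proof.
  intros Hl Hm.
  assert (HN : 0 < INR (S M)) by (apply lt_0_INR; lia).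
  set (t := (INR l - INR m) * (2 * PI / INR (S M))).
  rewrite (sum_n_ext _ (fun k => (cis t ^ k)%C)).
  2:{ intros k. unfold unity_root.
      rewrite !cis_pow, cis_conj, <- cis_plus. f_equal. unfold t. ring. }
  destruct (Nat.eqb_spec l m) as [->|Hlm].
  - rewrite (sum_n_ext _ (fun k => RtoC 1)).
    + now rewrite <- csum_RtoC, sum_n_const, Rmult_1_r.
    + intros k. unfold t. rewrite cis_pow.
      replace (INR k * _) with 0 by ring.
      unfold cis. now rewrite cos_0, sin_0.
  - assert (Hw : (cis t ^ S M)%C = 1).
    { rewrite cis_pow. unfold t.
      replace (INR (S M) * _) with (INR l * (2 * PI) + - (INR m * (2 * PI)))
        by (field; lra).
      rewrite cis_plus, <- cis_conj, <- !cis_pow.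
      replace (cis (2 * PI)) with (RtoC 1)
        by (unfold cis; now rewrite cos_2PI, sin_2PI).
      rewrite !Cpow_1_l. unfold Cconj, RtoC, Cmult; simpl. f_equal; ring. }
    assert (Ht : cis t <> 1).
    { pose proof PI_RGT_0 as HPI.
      assert (HlR : 0 <= INR l < INR (S M)) by (split; [apply pos_INR|apply lt_INR; lia]).
      assert (HmR : 0 <= INR m < INR (S M)) by (split; [apply pos_INR|apply lt_INR; lia]).
      assert (Hd : 0 < 2 * PI / INR (S M)) by (apply Rdiv_lt_0_compat; lra).
      assert (Hd' : INR (S M) * (2 * PI / INR (S M)) = 2 * PI) by (field; lra).
      apply cis_neq_1.
      - unfold t. apply Rmult_integral_contrapositive. split; [|lra].
        intros E. apply Hlm, INR_eq. lra.
      - unfold t. set (d := 2 * PI / INR (S M)) in *.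
        split; nra. }
    pose proof (geometric_sum (cis t) M) as Hg.
    rewrite Hw in Hg.
    assert (Hnz : (cis t - 1)%C <> 0).
    { intros E. apply Ht. replace (cis t) with ((cis t - 1) + 1)%C by ring.
      rewrite E. ring. }
    replace (sum_n (fun k => (cis t ^ k)%C) M)
      with (/ (cis t - 1) * ((cis t - 1) * sum_n (fun k => (cis t ^ k)%C) M))%C
      by (rewrite Cmult_assoc, Cinv_l by assumption; apply Cmult_1_l).
    rewrite Hg. cring.
Qed.

Definition poly_eval (c : nat -> C) (M : nat) (z : C) : C :=
  sum_n (fun l => (c l * z ^ l)%C) M.

(** The degree bound [M] is below the number [S M] of sample points, so no two
    exponents are congruent modulo [S M] and the cross terms cancel by
    orthogonality. *)
Lemma parseval (c : nat -> C) (M : nat) :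
  sum_n (fun k => Cmod (poly_eval c M (unity_root (S M) ^ k)) ^ 2) M
  = INR (S M) * sum_n (fun l => Cmod (c l) ^ 2) M.
Proof.
  apply RtoC_inj.
  rewrite RtoC_mult, !csum_RtoC.
  set (w := unity_root (S M)).
  rewrite (sum_n_ext _ (fun k => sum_n (fun l => sum_n (fun m =>
    (c l * Cconj (c m) * ((w ^ k) ^ l * Cconj ((w ^ k) ^ m)))%C) M) M)).
  2:{ intros k. rewrite Cmod2_conj. unfold poly_eval.
      rewrite csum_conj, <- csum_mult_r.
      apply sum_n_ext. intros l. rewrite <- csum_mult_l.
      apply sum_n_ext. intros m. rewrite Cmult_conj. cring. }
  rewrite sum_n_switch, <- csum_mult_l.
  apply sum_n_ext_loc. intros l Hl.
  rewrite sum_n_switch.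
  rewrite (sum_n_ext_loc _ (fun m => (c l * Cconj (c m)
     * (if Nat.eqb l m then RtoC (INR (S M)) else RtoC 0))%C)).
  2:{ intros m Hm. rewrite csum_mult_l. f_equal.
      now apply unity_root_orthogonality. }
  rewrite (sum_single _ l) by
    (try assumption; intros m Hm; rewrite (proj2 (Nat.eqb_neq l m)) by auto;
     apply Cmult_0_r).
  rewrite Nat.eqb_refl, Cmod2_conj. cring.
Qed.

(** * Multiplying a bounded polynomial by a trinomial *)

(** The coefficients of [z^k] times the power series with coefficients [c]. *)
Definition shift (k : nat) (c : nat -> C) (m : nat) : C :=
  if Nat.leb k m then c (m - k)%nat else 0.

Lemma poly_eval_shift (k : nat) (c : nat -> C) (L M : nat) (z : C) :
  (L + k <= M)%nat -> (forall l, (L < l)%nat -> c l = 0) ->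
  poly_eval (shift k c) M z = (z ^ k * poly_eval c L z)%C.
Proof.
  intros HM Hc. unfold poly_eval.
  rewrite (sum_zero_above _ (L + k) M HM).
  2:{ intros m Hm. unfold shift.
      rewrite (proj2 (Nat.leb_le k m)), Hc by lia. apply Cmult_0_l. }
  clear HM Hc M.
  induction L as [|L IH].
  - rewrite sum_O. simpl Nat.add.
    transitivity (shift k c k * z ^ k)%C.
    + destruct k as [|k]; [apply sum_O|].
      rewrite csum_S, sum_zero; [apply Cplus_0_l|].
      intros m Hm. unfold shift.
      rewrite (proj2 (Nat.leb_gt (S k) m)) by lia. apply Cmult_0_l.
    + unfold shift. rewrite Nat.leb_refl, Nat.sub_diag. simpl. ring.
  - simpl Nat.add. rewrite !csum_S, IH.
    replace (S (L + k)) with (S L + k)%nat by lia.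
    unfold shift. rewrite (proj2 (Nat.leb_le k (S L + k))) by lia.
    replace (S L + k - k)%nat with (S L) by lia.
    rewrite Cpow_add_r. ring.
Qed.

(** The coefficients of the product of [p0 + p1 z^n + p2 z^(2n)] with the
    series whose coefficients are [c]. *)
Definition trinomial_mult (n : nat) (p0 p1 p2 : C) (c : nat -> C) (m : nat) : C :=
  (p0 * c m + p1 * shift n c m + p2 * shift (2 * n) c m)%C.

Lemma poly_eval_trinomial_mult (n : nat) (p0 p1 p2 : C) (c : nat -> C) (L M : nat) (z : C) :
  (L + 2 * n <= M)%nat -> (forall l, (L < l)%nat -> c l = 0) ->
  poly_eval (trinomial_mult n p0 p1 p2 c) M z
  = ((p0 + p1 * z ^ n + p2 * z ^ (2 * n)) * poly_eval c L z)%C.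
Proof.
  intros HM Hc.
  transitivity (p0 * poly_eval c M z + p1 * poly_eval (shift n c) M z
                + p2 * poly_eval (shift (2 * n) c) M z)%C.
  - unfold poly_eval. rewrite <- !csum_mult_l.
    rewrite <- !(sum_n_plus (G := C_AbelianMonoid)).
    apply sum_n_ext. intros m. unfold trinomial_mult.
    change plus with Cplus. cring.
  - rewrite !(poly_eval_shift _ c L M) by (assumption || lia).
    replace (poly_eval c M z) with (poly_eval c L z); [ring|].
    symmetry. apply sum_zero_above; [lia|].
    intros l Hl. rewrite Hc by assumption. apply Cmult_0_l.
Qed.

(** Only the coefficients of index [0], [n], [2n] matter; this sequence
    lets them be selected inside a Parseval sum by a termwise comparison. *)
Definition three_points (n : nat) (x0 x1 x2 : R) (m : nat) : R :=
  (if Nat.eqb m 0 then x0 else 0) + (if Nat.eqb m n then x1 else 0)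
  + (if Nat.eqb m (2 * n) then x2 else 0).

Lemma sum_three_points (n : nat) (x0 x1 x2 : R) (M : nat) :
  (2 * n <= M)%nat -> sum_n (three_points n x0 x1 x2) M = x0 + x1 + x2.
Proof.
  intros HM.
  assert (Hdelta : forall j x, (j <= M)%nat ->
    sum_n (fun m => if Nat.eqb m j then x else 0) M = x).
  { intros j x Hj. rewrite (sum_single _ j M Hj).
    - now rewrite Nat.eqb_refl.
    - intros k Hk. now rewrite (proj2 (Nat.eqb_neq k j) Hk). }
  unfold three_points.
  rewrite !(sum_n_plus (G := R_AbelianMonoid)), !Hdelta by lia. reflexivity.
Qed.

Lemma trinomial_mult_one_norm (n : nat) (p0 p1 p2 : C) (m : nat) :
  (1 <= n)%nat ->
  Cmod (trinomial_mult n p0 p1 p2 (fun l => if Nat.eqb l 0 then 1 else 0) m) ^ 2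
  = three_points n (Cmod p0 ^ 2) (Cmod p1 ^ 2) (Cmod p2 ^ 2) m.
Proof.
  intros Hn. unfold trinomial_mult, shift, three_points.
  destruct (Nat.eqb_spec m 0), (Nat.eqb_spec m n), (Nat.eqb_spec m (2 * n)),
    (Nat.leb_spec n m), (Nat.leb_spec (2 * n) m); try lia;
  destruct (Nat.eqb_spec (m - n) 0), (Nat.eqb_spec (m - 2 * n) 0); try lia;
  rewrite ?Cmult_0_r, ?Cmult_1_r, ?Cplus_0_l, ?Cplus_0_r, ?Cmod_0; ring.
Qed.

(** Bessel's inequality in termwise form: the coefficients of index other than
    [0], [n], [2n] are discarded. *)
Lemma trinomial_mult_norm_ge (n : nat) (p0 p1 p2 : C) (c : nat -> C) (m : nat) :
  (1 <= n)%nat ->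
  three_points n (Cmod (c 0%nat * p0) ^ 2)
    (Cmod (c n * p0 + c 0%nat * p1) ^ 2)
    (Cmod (c (2 * n)%nat * p0 + c n * p1 + c 0%nat * p2) ^ 2) m
  <= Cmod (trinomial_mult n p0 p1 p2 c m) ^ 2.
Proof.
  intros Hn. unfold three_points.
  destruct (Nat.eqb_spec m 0), (Nat.eqb_spec m n), (Nat.eqb_spec m (2 * n));
    try lia; unfold trinomial_mult, shift.
  - subst m.
    rewrite (proj2 (Nat.leb_gt n 0)), (proj2 (Nat.leb_gt (2 * n) 0)) by lia.
    rewrite !Rplus_0_r. right. do 2 f_equal. ring.
  - subst m.
    rewrite Nat.leb_refl, Nat.sub_diag, (proj2 (Nat.leb_gt (2 * n) n)) by lia.
    rewrite Rplus_0_r, Rplus_0_l. right. do 2 f_equal. ring.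
  - subst m.
    rewrite Nat.leb_refl, Nat.sub_diag, (proj2 (Nat.leb_le n (2 * n))) by lia.
    replace (2 * n - n)%nat with n by lia.
    rewrite !Rplus_0_l. right. do 2 f_equal. ring.
  - rewrite !Rplus_0_r. apply pow2_ge_0.
Qed.

Lemma sum_le (u v : nat -> R) (M : nat) :
  (forall m, u m <= v m) -> sum_n u M <= sum_n v M.
Proof. intros H. now apply sum_n_m_le. Qed.

(** Parseval's identity is applied to the trinomial [p] and to the product of
    [p] with the polynomial, which is at most [K |p|] on the circle.  Writing
    the trinomial as its product with the constant [1] lets the same
    formulas serve for both. *)
Lemma bounded_polynomial_toeplitz (c : nat -> C) (L n : nat) (K : R) (p0 p1 p2 : C) :
  (1 <= n)%nat -> (forall l, (L < l)%nat -> c l = 0) ->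
  (forall z, Cmod z = 1 -> Cmod (poly_eval c L z) <= K) ->
  Cmod (c 0%nat * p0) ^ 2 + Cmod (c n * p0 + c 0%nat * p1) ^ 2
    + Cmod (c (2 * n)%nat * p0 + c n * p1 + c 0%nat * p2) ^ 2
  <= K ^ 2 * (Cmod p0 ^ 2 + Cmod p1 ^ 2 + Cmod p2 ^ 2).
Proof.
  intros Hn Hc HK.
  (* The degree of the product of the polynomial with the trinomial. *)
  set (M := (L + 2 * n)%nat).
  set (one := fun l : nat => if Nat.eqb l 0 then RtoC 1 else RtoC 0).
  rewrite <- (sum_three_points n _ _ _ M) by lia.
  rewrite <- (sum_three_points n (Cmod p0 ^ 2) _ _ M) by lia.
  rewrite (sum_n_ext (three_points n (Cmod p0 ^ 2) _ _)
             (fun m => Cmod (trinomial_mult n p0 p1 p2 one m) ^ 2))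
    by (intros m; symmetry; now apply trinomial_mult_one_norm).
  eapply Rle_trans; [apply sum_le; intros m; now apply trinomial_mult_norm_ge|].
  assert (HN : 0 < INR (S M)) by (apply lt_0_INR; lia).
  apply (Rmult_le_reg_l (INR (S M))); [assumption|].
  rewrite (Rmult_comm (K ^ 2)), <- Rmult_assoc, <- !parseval, Rmult_comm.
  rewrite <- (sum_n_mult_l (K := R_Ring)).
  apply sum_le. intros k.
  set (w := (unity_root (S M) ^ k)%C).
  assert (Hw : Cmod w = 1)
    by (unfold w, unity_root; rewrite cis_pow; apply Cmod_cis).
  rewrite (poly_eval_trinomial_mult n p0 p1 p2 c L M) by (assumption || lia).
  rewrite (poly_eval_trinomial_mult n p0 p1 p2 one 0 M)
    by first [lia | intros [|l] Hl; [lia|reflexivity]].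
  replace (poly_eval one 0 w) with (RtoC 1)
    by (unfold poly_eval; rewrite sum_O; simpl; now rewrite Cmult_1_l).
  rewrite Cmult_1_r, Cmod_mult, Rpow_mult_distr.
  change (mult (K ^ 2)) with (Rmult (K ^ 2)).
  rewrite (Rmult_comm (K ^ 2)).
  apply Rmult_le_compat_l; [apply pow2_ge_0|].
  apply pow_incr. split; [apply Cmod_ge_0|now apply HK].
Qed.

(** * Partial sums on a smaller circle *)

(** A term is the difference of two consecutive partial sums, and these are
    bounded since they converge. *)
Lemma bounded_scaled_coefficients (f : C -> C) (a : nat -> C) (r : R) :
  0 < r < 1 ->
  (forall z : C, unit_disk z -> @is_pseries C_AbsRing C_NormedModule a z (f z)) ->
  exists B, forall l, Cmod (a l) * r ^ l <= B.
Proof.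
  intros Hr Hf.
  assert (Hdisk : unit_disk r)
    by (unfold unit_disk; rewrite Cmod_R, Rabs_pos_eq; lra).
  destruct (filterlim_bounded (K := C_AbsRing) (V := C_NormedModule)
    (sum_n (fun k => (RtoC r ^ k * a k)%C))) as [B HB].
  { exists (f r). exact (Hf r Hdisk). }
  change (forall l, Cmod (sum_n (fun k => (RtoC r ^ k * a k)%C) l) <= B) in HB.
  exists (2 * B). intros l.
  replace (Cmod (a l) * r ^ l) with (Cmod (RtoC r ^ l * a l))
    by (rewrite Cmod_mult, Cmod_pow, Cmod_R, Rabs_pos_eq by lra; ring).
  destruct l as [|l].
  - pose proof (HB 0%nat) as H0. rewrite sum_O in H0.
    pose proof (Cmod_ge_0 (RtoC r ^ 0 * a 0%nat)). lra.
  - pose proof (HB l) as H1. pose proof (HB (S l)) as H2.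
    rewrite csum_S in H2.
    set (s := sum_n _ l) in *. set (t := (RtoC r ^ S l * a (S l))%C) in *.
    replace t with ((s + t) + - s)%C by ring.
    eapply Rle_trans; [apply Cmod_triangle|]. rewrite Cmod_opp. lra.
Qed.

(** The factor [1 - q ^ d] makes the bound additive in [d], so that it can be
    proved by induction; the use made of it is that it is at most [1]. *)
Lemma geometric_tail (u : nat -> C) (B q : R) (L d : nat) :
  0 < q < 1 -> (forall l, Cmod (u l) <= B * q ^ l) ->
  Cmod (sum_n u (L + d) - sum_n u L) <= B * q ^ L / (1 - q) * (1 - q ^ d).
Proof.
  intros Hq Hu. induction d as [|d IH].
  - rewrite Nat.add_0_r. replace (_ - _)%C with (RtoC 0) by ring.
    rewrite Cmod_0. simpl. lra.
  - rewrite Nat.add_succ_r, csum_S.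
    replace (_ - _)%C with ((sum_n u (L + d) - sum_n u L) + u (S (L + d)))%C by ring.
    eapply Rle_trans; [apply Cmod_triangle|].
    pose proof (Hu (S (L + d))) as Hlast.
    assert (HB : 0 <= B).
    { pose proof (Hu 0%nat). pose proof (Cmod_ge_0 (u 0%nat)). simpl in *. lra. }
    assert (Hstep : B * q ^ S (L + d) <= B * q ^ L * q ^ d).
    { simpl. rewrite Rmult_assoc, <- pow_add.
      apply Rmult_le_compat_l; [assumption|].
      pose proof (pow_lt q (L + d)). nra. }
    replace (B * q ^ L / (1 - q) * (1 - q ^ S d))
      with (B * q ^ L / (1 - q) * (1 - q ^ d) + B * q ^ L * q ^ d)
      by (simpl; field; lra).
    lra.
Qed.

(** Partial sums converge to [f] uniformly on the circle of radius [r], by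
    comparison with a geometric series of ratio [r / rho], [r < rho < 1].
    Uniformity is essential: the order of the roots of unity at which the
    polynomial is sampled depends on its degree [L]. *)
Lemma partial_sums_nearly_schur (f : C -> C) (a : nat -> C) (r eps : R) (n : nat) :
  (forall z : C, unit_disk z -> closed_unit_disk (f z)) ->
  (forall z : C, unit_disk z -> @is_pseries C_AbsRing C_NormedModule a z (f z)) ->
  0 < r < 1 -> 0 < eps ->
  exists L, (n <= L)%nat /\ forall z, Cmod z = 1 ->
    Cmod (poly_eval (fun l => (a l * RtoC r ^ l)%C) L z) <= 1 + eps.
Proof.
  intros Hmaps Hf Hr Heps.
  set (rho := (1 + r) / 2).
  destruct (bounded_scaled_coefficients f a rho) as [B HB]; [unfold rho; lra|assumption|].
  assert (HB0 : 0 <= B).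
  { pose proof (HB 0%nat). pose proof (Cmod_ge_0 (a 0%nat)). simpl in *. lra. }
  set (q := r / rho).
  assert (Hrho : 0 < rho) by (unfold rho; lra).
  assert (Hqr : q * rho = r) by (unfold q; field; lra).
  assert (Hq : 0 < q < 1).
  { split; [apply Rdiv_lt_0_compat; lra|].
    apply (Rmult_lt_reg_r rho); [lra|]. rewrite Hqr. unfold rho; lra. }
  destruct (pow_lt_1_zero q) with (y := eps / 2 * (1 - q) / (B + 1)) as [L0 HL0].
  { rewrite Rabs_pos_eq; lra. }
  { apply Rdiv_lt_0_compat; nra. }
  set (L := Nat.max n L0).
  exists L. split; [lia|]. intros z Hz.
  specialize (HL0 L ltac:(lia)).
  pose proof (pow_lt q L ltac:(lra)) as HqL.
  rewrite Rabs_pos_eq in HL0 by lra.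
  assert (Htail : B * q ^ L / (1 - q) <= eps / 2).
  { apply (Rmult_le_reg_r (1 - q)); [lra|].
    replace (B * q ^ L / (1 - q) * (1 - q)) with (B * q ^ L) by (field; lra).
    apply (Rmult_lt_compat_r (B + 1)) in HL0; [|lra].
    replace (eps / 2 * (1 - q) / (B + 1) * (B + 1)) with (eps / 2 * (1 - q)) in HL0
      by (field; lra).
    lra. }
  set (u := fun l => (a l * RtoC r ^ l * z ^ l)%C).
  assert (Hu : forall l, Cmod (u l) <= B * q ^ l).
  { intros l. unfold u.
    rewrite !Cmod_mult, !Cmod_pow, Hz, pow1, Rmult_1_r, Cmod_R, Rabs_pos_eq by lra.
    rewrite <- Hqr, Rpow_mult_distr.
    pose proof (HB l). pose proof (pow_lt q l). nra. }
  assert (Hdisk : unit_disk (RtoC r * z))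
    by (unfold unit_disk; rewrite Cmod_mult, Hz, Cmod_R, Rabs_pos_eq; lra).
  assert (Hlim : filterlim (sum_n u) eventually
                   (@locally C_NormedModule (f (RtoC r * z)%C))).
  { eapply filterlim_ext; [|exact (Hf _ Hdisk)].
    intros m. apply sum_n_ext. intros l.
    change ((RtoC r * z) ^ l * a l = u l)%C.
    unfold u. rewrite Cpow_mult_l. ring. }
  assert (Heps2 : 0 < eps / 2) by lra.
  pose proof (proj1 (filterlim_locally_ball_norm _ _) Hlim (mkposreal _ Heps2))
    as [M0 HM0].
  specialize (HM0 (L + M0)%nat ltac:(lia)).
  change (Cmod (sum_n u (L + M0) - f (RtoC r * z)%C) < eps / 2) in HM0.
  pose proof (geometric_tail u B q L M0 Hq Hu) as HT.
  pose proof (pow_lt q M0 ltac:(lra)) as HqM.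
  assert (HT' : Cmod (sum_n u (L + M0) - sum_n u L) <= eps / 2).
  { eapply Rle_trans; [exact HT|].
    assert (0 <= B * q ^ L / (1 - q)).
    { apply Rmult_le_pos; [nra|]. apply Rlt_le, Rinv_0_lt_compat; lra. }
    nra. }
  pose proof (Hmaps _ Hdisk) as Hf1. unfold closed_unit_disk in Hf1.
  change (Cmod (sum_n u L) <= 1 + eps).
  set (s := sum_n u L) in *. set (S' := sum_n u (L + M0)) in *.
  set (w := f (RtoC r * z)%C) in *.
  replace s with (w + ((S' - w) + - (S' - s)))%C by ring.
  eapply Rle_trans; [apply Cmod_triangle|].
  eapply Rle_trans; [apply Rplus_le_compat_l, Cmod_triangle|].
  rewrite Cmod_opp. lra.
Qed.

(** * The Toeplitz contraction attached to a bounded power series *)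

(** The lower triangular Toeplitz matrix with first column [(a, b, c)] does not
    increase the Euclidean norm on [C^3]. *)
Definition toeplitz_contraction (a b c : C) : Prop :=
  forall p0 p1 p2 : C,
  Cmod (a * p0) ^ 2 + Cmod (b * p0 + a * p1) ^ 2
    + Cmod (c * p0 + b * p1 + a * p2) ^ 2
  <= Cmod p0 ^ 2 + Cmod p1 ^ 2 + Cmod p2 ^ 2.

Lemma bernoulli_below (e : R) (m : nat) : 0 <= e <= 1 -> 1 - INR m * e <= (1 - e) ^ m.
Proof.
  intros He. induction m as [|m IH].
  - simpl. lra.
  - rewrite S_INR. simpl.
    pose proof (pos_INR m).
    assert (0 <= INR m * e * e) by (repeat apply Rmult_le_pos; lra). nra.
Qed.

(** To first order in [e] the two factors are at least [1 - m e] and at most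
    [1 + 3 e], so the hypothesis gives [X - Y <= (m X + 3 Y) e]. *)
Lemma radial_limit_le (X Y : R) (m : nat) :
  0 <= X -> 0 <= Y ->
  (forall e, 0 < e < 1 -> (1 - e) ^ m * X <= (1 + e) ^ 2 * Y) -> X <= Y.
Proof.
  intros HX HY H. apply le_epsilon. intros eta Heta.
  pose proof (pos_INR m) as Hm.
  set (D := INR m * X + 3 * Y + 1).
  assert (HD : 0 < D) by (unfold D; nra).
  set (e := Rmin (1 / 2) (eta / D)).
  assert (He : 0 < e < 1).
  { unfold e. split; [apply Rmin_glb_lt; [lra|now apply Rdiv_lt_0_compat]|].
    eapply Rle_lt_trans; [apply Rmin_l|lra]. }
  assert (HeD : e * D <= eta).
  { replace eta with (eta / D * D) by (field; lra).
    apply Rmult_le_compat_r; [lra|apply Rmin_r]. }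
  specialize (H e He).
  pose proof (bernoulli_below e m ltac:(lra)) as Hb.
  assert (H1 : (1 - INR m * e) * X <= (1 - e) ^ m * X)
    by now apply Rmult_le_compat_r.
  assert (H2 : (1 + e) ^ 2 * Y <= (1 + 3 * e) * Y)
    by (apply Rmult_le_compat_r; nra).
  unfold D in HeD. nra.
Qed.

(** The polynomial estimate is applied to the truncation [c] of [f (r z)] and to
    the coefficients [p0], [p1 r^n], [p2 r^(2n)].  These make the powers of
    [r] factor out of each row, and the outcome is [r^(4n) |T p|^2 <= (1 + e)^2
    |p|^2]; with [r = 1 - e] there is a single limit to take. *)
Lemma schur_toeplitz_contraction (f : C -> C) (a : nat -> C) (n : nat) :
  (forall z : C, unit_disk z -> closed_unit_disk (f z)) ->
  (forall z : C, unit_disk z -> @is_pseries C_AbsRing C_NormedModule a z (f z)) ->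
  (1 <= n)%nat ->
  toeplitz_contraction (a 0%nat) (a n) (a (2 * n)%nat).
Proof.
  intros Hmaps Hf Hn p0 p1 p2.
  apply (radial_limit_le _ _ (4 * n)).
  1, 2: repeat apply Rplus_le_le_0_compat; apply pow2_ge_0.
  intros e He. set (r := 1 - e).
  destruct (partial_sums_nearly_schur f a r e (2 * n) Hmaps Hf) as [L [HL Hbound]];
    try (unfold r; lra).
  set (c := fun l => if Nat.leb l L then (a l * RtoC r ^ l)%C else RtoC 0).
  assert (Hc : forall l, (l <= L)%nat -> c l = (a l * RtoC r ^ l)%C)
    by (intros l Hl; unfold c; now rewrite (proj2 (Nat.leb_le l L) Hl)).
  assert (Hc0 : forall l, (L < l)%nat -> c l = 0)
    by (intros l Hl; unfold c; now rewrite (proj2 (Nat.leb_gt l L) Hl)).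
  assert (HcK : forall z, Cmod z = 1 -> Cmod (poly_eval c L z) <= 1 + e).
  { intros z Hz.
    replace (poly_eval c L z)
      with (poly_eval (fun l => (a l * RtoC r ^ l)%C) L z) by
      (apply sum_n_ext_loc; intros l Hl; now rewrite Hc).
    now apply Hbound. }
  pose proof (bounded_polynomial_toeplitz c L n (1 + e)
    p0 (p1 * RtoC r ^ n) (p2 * RtoC r ^ (2 * n)) Hn Hc0 HcK) as H.
  rewrite !Hc in H by lia.
  replace (a n * RtoC r ^ n * p0 + a 0%nat * RtoC r ^ 0 * (p1 * RtoC r ^ n))%C
    with (RtoC r ^ n * (a n * p0 + a 0%nat * p1))%C in H by (simpl; ring).
  replace (a (2 * n)%nat * RtoC r ^ (2 * n) * p0 + a n * RtoC r ^ n * (p1 * RtoC r ^ n)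
           + a 0%nat * RtoC r ^ 0 * (p2 * RtoC r ^ (2 * n)))%C
    with (RtoC r ^ (2 * n) * (a (2 * n)%nat * p0 + a n * p1 + a 0%nat * p2))%C in H
    by (replace (2 * n)%nat with (n + n)%nat by lia; rewrite Cpow_add_r; simpl; ring).
  replace (a 0%nat * RtoC r ^ 0)%C with (a 0%nat) in H by (simpl; ring).
  rewrite (Cmod_mult p1), (Cmod_mult p2) in H.
  rewrite (Cmod_mult (RtoC r ^ n)), (Cmod_mult (RtoC r ^ (2 * n))) in H.
  rewrite !Cmod_pow, Cmod_R, Rabs_pos_eq, !Rpow_mult_distr in H by (unfold r; lra).
  assert (Hr : 0 < r < 1) by (unfold r; lra).
  assert (Hs : 0 < (r ^ n) ^ 2 <= 1).
  { split; [now apply pow_lt, pow_lt|].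
    rewrite <- pow_mult, <- (pow1 (n * 2)). apply pow_incr. lra. }
  set (s := (r ^ n) ^ 2) in *.
  replace ((r ^ (2 * n)) ^ 2) with (s ^ 2) in H
    by (unfold s; rewrite <- !pow_mult; f_equal; lia).
  replace (r ^ (4 * n)) with (s ^ 2)
    by (unfold s; rewrite <- !pow_mult; f_equal; lia).
  assert (Hs2 : 0 < s ^ 2 <= s) by nra.
  set (X0 := Cmod _ ^ 2) in *. set (X1 := Cmod (_ + _) ^ 2) in *.
  set (X2 := Cmod (_ + _ + _) ^ 2) in *.
  set (Y0 := Cmod p0 ^ 2) in *. set (Y1 := Cmod p1 ^ 2) in *.
  set (Y2 := Cmod p2 ^ 2) in *.
  assert (0 <= X0 /\ 0 <= X1 /\ 0 <= Y1 /\ 0 <= Y2)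
    by (repeat split; apply pow2_ge_0).
  eapply Rle_trans; [|eapply Rle_trans; [exact H|]].
  - nra.
  - apply Rmult_le_compat_l; [apply pow2_ge_0|]. nra.
Qed.

(** * From the contraction to the coefficient estimate *)

(** With [y = T x] this is the identity behind the Schwarz-Pick lemma: it
    transfers contractivity from [T] to [(T - a) (1 - a^* T)^(-1)].  It is used
    one coordinate at a time. *)
Lemma pick_identity (a x y : C) :
  Cmod (x - Cconj a * y) ^ 2 - Cmod (y - a * x) ^ 2
  = (1 - Cmod a ^ 2) * (Cmod x ^ 2 - Cmod y ^ 2).
Proof.
  rewrite !Cmod2_alt. destruct a, x, y; simpl. ring.
Qed.

Lemma exists_aligning_phase (z w : C) :
  exists u : C, Cmod u = 1 /\ Cmod (z + w * u) = Cmod z + Cmod w.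
Proof.
  destruct (Ceq_dec z 0) as [->|Hz].
  { exists 1. rewrite Cmod_1, Cmult_1_r, Cplus_0_l, Cmod_0. split; lra. }
  destruct (Ceq_dec w 0) as [->|Hw].
  { exists 1. rewrite Cmod_1, Cmult_1_r, Cplus_0_r, Cmod_0. split; lra. }
  pose proof (proj1 (Cmod_gt_0 z) Hz) as Pz.
  pose proof (proj1 (Cmod_gt_0 w) Hw) as Pw.
  assert (Hz' : RtoC (Cmod z) <> 0) by (intros E; apply RtoC_inj in E; lra).
  exists (z * RtoC (Cmod w) / (RtoC (Cmod z) * w))%C. split.
  - rewrite Cmod_div by now apply Cmult_neq_0.
    rewrite !Cmod_mult, !Cmod_R, !Rabs_pos_eq by lra. field; lra.
  - replace (z + _)%C with (z * RtoC (1 + Cmod w / Cmod z))%C.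
    + rewrite Cmod_mult, Cmod_R, Rabs_pos_eq; [field; lra|].
      apply Rplus_le_le_0_compat; [lra|].
      apply Rlt_le, Rdiv_lt_0_compat; lra.
    + rewrite RtoC_plus, RtoC_div by lra. field. now split.
Qed.

(** The vector [h = (h0, h1, h2)] below is [(1 - a^* T)^(-1) (1, u, 0)], found by
    forward substitution, the diagonal of [1 - a^* T] being [A]. *)
Lemma toeplitz_contraction_coefficients (a b c : C) :
  toeplitz_contraction a b c ->
  1 - Cmod a ^ 2 - Cmod b >=
  Cmod (c * RtoC (1 - Cmod a ^ 2) + b ^ 2 * Cconj a)
  / (2 * (1 - Cmod a ^ 2)).
Proof.
  intros HT.
  pose proof (HT 1 0 0) as Hcol.
  rewrite !Cmult_0_r, !Cmult_1_r, !Cplus_0_r, Cmod_0, Cmod_1 in Hcol.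
  pose proof (pow2_ge_0 (Cmod b)). pose proof (pow2_ge_0 (Cmod c)).
  destruct (Req_dec (Cmod a ^ 2) 1) as [Ha|Ha].
  - assert (Hb : b = 0) by (apply Cmod_eq_0, Rsqr_0_uniq; unfold Rsqr; nra).
    assert (Hc : c = 0) by (apply Cmod_eq_0, Rsqr_0_uniq; unfold Rsqr; nra).
    rewrite Hb, Hc, Ha.
    replace (0 * _ + _)%C with (RtoC 0) by ring.
    rewrite Cmod_0. unfold Rdiv. rewrite Rmult_0_l. lra.
  - set (A := 1 - Cmod a ^ 2).
    assert (HA : 0 < A) by (unfold A in *; lra).
    assert (HAC : RtoC A <> 0) by (intros E; apply RtoC_inj in E; lra).
    assert (HAa : RtoC A = (1 - a * Cconj a)%C)
      by (unfold A; now rewrite RtoC_minus, Cmod2_conj).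
    set (g0 := (b / A)%C).
    set (g1 := ((c * A + b ^ 2 * Cconj a) / (A * A))%C).
    destruct (exists_aligning_phase g1 g0) as [u [Hu Hgu]].
    set (h0 := (1 / A)%C).
    set (h1 := ((u + Cconj a * b * h0) / A)%C).
    set (h2 := (Cconj a * (b * h1 + c * h0) / A)%C).
    pose proof (HT h0 h1 h2) as Hh.
    pose proof (pick_identity a h0 (a * h0)) as I0.
    pose proof (pick_identity a h1 (b * h0 + a * h1)) as I1.
    pose proof (pick_identity a h2 (c * h0 + b * h1 + a * h2)) as I2.
    fold A in I0, I1, I2.
    (* Multiplication by 1 - a^* a undoes the division by A in the definition of
       h0, h1, h2. *)
    assert (Hsolve : forall h s : C, (h * A = s)%C -> (h - Cconj a * (a * h) = s)%C)
      by (intros h s <-; rewrite HAa; ring).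
    replace (h0 - Cconj a * (a * h0))%C with (RtoC 1) in I0
      by (symmetry; apply Hsolve; unfold h0; field; assumption).
    replace (a * h0 - a * h0)%C with (RtoC 0) in I0 by ring.
    replace (h1 - Cconj a * (b * h0 + a * h1))%C with u in I1.
    2:{ replace (h1 - Cconj a * (b * h0 + a * h1))%C
          with ((h1 - Cconj a * (a * h1)) - Cconj a * b * h0)%C by ring.
        rewrite (Hsolve h1 (u + Cconj a * b * h0)%C)
          by (unfold h1; field; assumption). ring. }
    replace (b * h0 + a * h1 - a * h1)%C with g0 in I1
      by (unfold h0, g0; field; assumption).
    replace (h2 - Cconj a * (c * h0 + b * h1 + a * h2))%C with (RtoC 0) in I2.
    2:{ replace (h2 - Cconj a * (c * h0 + b * h1 + a * h2))%C
          with ((h2 - Cconj a * (a * h2)) - Cconj a * (b * h1 + c * h0))%C by ring.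
        rewrite (Hsolve h2 (Cconj a * (b * h1 + c * h0))%C)
          by (unfold h2; field; assumption). ring. }
    replace (c * h0 + b * h1 + a * h2 - a * h2)%C with (g1 + g0 * u)%C in I2
      by (unfold h1, h0, g0, g1; field; assumption).
    rewrite Cmod_1, Cmod_0 in I0. rewrite Hu in I1. rewrite Cmod_0, Hgu in I2.
    (* The sum of the three identities: |k|^2 - |(T - a) h|^2 >= 0, where
       k = (1, u, 0) and (T - a) h = (0, g0, g1 + g0 u). *)
    assert (Hg : Cmod g0 ^ 2 + (Cmod g1 + Cmod g0) ^ 2 <= 2).
    { assert (0 <= A * ((Cmod h0 ^ 2 + Cmod h1 ^ 2 + Cmod h2 ^ 2)
         - (Cmod (a * h0) ^ 2 + Cmod (b * h0 + a * h1) ^ 2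
            + Cmod (c * h0 + b * h1 + a * h2) ^ 2)))
        by (apply Rmult_le_pos; lra).
      lra. }
    assert (Hg1 : Cmod g1 <= 2 * (1 - Cmod g0)).
    { pose proof (Cmod_ge_0 g0). pose proof (Cmod_ge_0 g1). nra. }
    unfold g0, g1 in Hg1.
    rewrite !Cmod_div, Cmod_mult, Cmod_R, Rabs_pos_eq in Hg1; try lra;
      try assumption; try (now apply Cmult_neq_0).
    apply Rle_ge.
    set (X := Cmod (c * A + b ^ 2 * Cconj a)) in *.
    replace (X / (2 * A)) with (A / 2 * (X / (A * A))) by (field; lra).
    replace (A - Cmod b) with (A / 2 * (2 * (1 - Cmod b / A))) by (field; lra).
    apply Rmult_le_compat_l; lra.
Qed.

Theorem corollary5p3 (f : C -> C) (a : nat -> C)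
  (f_analytic : analytic_on unit_disk f)
  (f_maps : forall z : C, unit_disk z -> closed_unit_disk (f z))
  (f_series : forall z : C, unit_disk z ->
     @is_pseries C_AbsRing C_NormedModule a z (f z)) :
  forall n : nat, (1 <= n)%nat ->
    1 - Cmod (a 0%nat) ^ 2 - Cmod (a n) >=
    Cmod (a (2 * n)%nat * RtoC (1 - Cmod (a 0%nat ^ 2)%C)
          + a n ^ 2 * Cconj (a 0%nat))%C
    / (2 * (1 - Cmod (a 0%nat) ^ 2)).
Proof.
  intros n Hn. rewrite Cmod_pow.
  apply toeplitz_contraction_coefficients.
  now apply (schur_toeplitz_contraction f).
Qed.
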